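(* Let $\mathcal{I}=\langle\mathbf{C},\mathbb{X},O,tr\rangle$ be a context interactive system with $\|\mathbf{C}\|$ countable and $tr$ of countable degree, and let $\langle\mathbb{X},\alpha_{\mathcal{I}}\rangle$ be the $\mathbf{H}$-coalgebra of its saturated transition system. Then $\mathbf{Coalg}_{\mathbf{H}}$ has a final object, and the kernel of the unique morphism $!$ from $\langle\mathbb{X},\alpha_{\mathcal{I}}\rangle$ to the final $\mathbf{H}$-coalgebra coincides with saturated bisimilarity: for all $i\in|\mathbf{C}|$ and $p,q\in X_i$, $p\sim^S_i q$ if and only if $!(p)=!(q)$.
   Context: Composition is in diagrammatic order: $d;e$ means first $d$, then $e$. $|\mathbf{C}|$ and $\|\mathbf{C}\|$ are the sets of objects and arrows of a small category $\mathbf{C}$. A $\Gamma(\mathbf{C})$-algebra $\mathbb{X}$ is a family of sets $X=(X_i)_{i\in|\mathbf{C}|}$ with a function $c_{\mathbb{X}}:X_i\to X_j$ for every $c\in\mathbf{C}[i,j]$ such that $(id_i)_{\mathbb{X}}=id_{X_i}$ and $(d;e)_{\mathbb{X}}(x)=e_{\mathbb{X}}(d_{\mathbb{X}}(x))$ (i.e. a functor $\mathbf{C}\to\mathbf{Set}$); homomorphisms are natural transformations; the category is $\mathbf{Alg}_{\Gamma(\mathbf{C})}$. $\int X=\sum_iX_i$ is the disjoint union. A context interactive system is a quadruple $\langle\mathbf{C},\mathbb{X},O,tr\rangle$ with $\mathbf{C}$ a small category, $\mathbb{X}$ a $\Gamma(\mathbf{C})$-algebra, $O$ a set (observations) and $tr\subseteq\int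 X\times O\times\int X$; write $p\xrightarrow{o}p'$ for $(p,o,p')\in tr$. Countable degree means that each state has at most countably many outgoing transitions. Saturated bisimilarity. A family of symmetric relations $R=(R_i\subseteq X_i\times X_i)_{i\in|\mathbf{C}|}$ is a saturated bisimulation iff, for all $i,j$ and $c\in\mathbf{C}[i,j]$, whenever $p\,R_i\,q$: (1) $c_{\mathbb{X}}(p)\,R_j\,c_{\mathbb{X}}(q)$; (2) if $p\xrightarrow{o}p'$ with $p'\in X_k$, then there is $q'\in X_k$ with $q\xrightarrow{o}q'$ and $p'\,R_k\,q'$. $p\sim^S_iq$ iff $p\,R_i\,q$ for some saturated bisimulation $R$. $\mathbf{G}(X)_i$ is the set of (at most) countable subsets of $\sum_{j\in|\mathbf{C}|}\mathbf{C}[i,j]\times O\times\int X$. The endofunctor $\mathbf{H}$ of $\mathbf{Alg}_{\Gamma(\mathbf{C})}$ maps $\mathbb{X}$ to the algebra with carrier $(\mathbf{G}(X)_i)_i$ and operations, for $d\in\mathbf{C}[i,k]$, $d_{\mathbf{H}(\mathbb{X})}(A)=\{(c_2,o,x)\mid (c_1,o,x)\in A,\ c_1=d;c_2\}$; on arrows $\mathbf{H}(h)(A)=\{(c,o,h(x))\mid(c,o,x)\in A\}$. An $\mathbf{H}$-coalgebra is a pair $\langle\mathbb{X},\alpha:\mathbb{X}\to\mathbf{H}(\mathbb{X})\rangle$; morphisms $\langle\mathbb{X},\alpha\rangle\to\langle\mathbb{Y},\beta\rangle$ are homomorphisms $f$ with $\alpha;\mathbf{H}(f)=f;\beta$. For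 $p\in X_i$, $\alpha_{\mathcal{I}}(p)=\{(c,o,q)\mid c\in\mathbf{C}[i,j]\text{ for some }j,\ (c_{\mathbb{X}}(p),o,q)\in tr\}$. *)

(* Defs.v *)
From mathcomp Require Import all_boot.
From mathcomp Require Import boolp classical_sets functions cardinality.

Set Implicit Arguments.
Unset Strict Implicit.
Unset Printing Implicit Defensive.

Local Open Scope classical_set_scope.

Lemma inj_existT (I : Type) (F : I -> Type) (i : I) (x y : F i) :
  existT F i x = existT F i y -> x = y.
Proof.
move=> E; rewrite -[RHS](projT2_eq E) /=.
by rewrite (Prop_irrelevance (projT1_eq E) erefl).
Qed.

Record smallCat := SmallCat {
  ob :> Type;
  hom : ob -> ob -> Type;
  idc : forall i, hom i i;
  comp : forall i j k, hom i j -> hom j k -> hom i k;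
  comp_idl : forall i j (c : hom i j), comp (idc i) c = c;
  comp_idr : forall i j (c : hom i j), comp c (idc j) = c;
  comp_assoc : forall i j k l (c : hom i j) (d : hom j k) (e : hom k l),
    comp c (comp d e) = comp (comp c d) e }.

Arguments hom : clear implicits.
Arguments idc {s} i.

(* Diagrammatic order: [d ;; e] is first [d], then [e]. *)
Notation "d ;; e" := (comp d e) (at level 50, left associativity).

Definition countable_arrows (C : smallCat) : Prop :=
  countable [set: {i : C & {j : C & hom C i j}}].

Record algebra (C : smallCat) := Algebra {
  carrier :> C -> Type;
  act : forall i j, hom C i j -> carrier i -> carrier j;
  act_id : forall i (x : carrier i), act (idc i) x = x;
  act_comp : forall i j k (d : hom C i j) (e : hom C j k) (x : carrier i),
    act (d ;; e) x = act e (act d x) }.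

Arguments act {C} a {i j} _ _.

Definition total (C : smallCat) (X : C -> Type) : Type := {i : C & X i}.

Record alg_hom (C : smallCat) (X Y : algebra C) := AlgHom {
  alg_fun :> forall i, X i -> Y i;
  alg_natural : forall i j (c : hom C i j) (x : X i),
    alg_fun (act X c x) = act Y c (alg_fun x) }.

Arguments alg_fun {C X Y} _ i _.

Lemma alg_hom_eq (C : smallCat) (X Y : algebra C) (f g : alg_hom X Y) :
  (forall i x, f i x = g i x) -> f = g.
Proof.
case: f g => [f hf] [g hg] /= fg.
have {}fg : f = g by apply: functional_extensionality_dep => i; apply: funext.
by case: _ / fg hg => hg; rewrite (Prop_irrelevance hf hg).
Qed.

Definition alg_idh (C : smallCat) (X : algebra C) : alg_hom X X :=
  @AlgHom C X X (fun _ x => x) (fun _ _ _ _ => erefl).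

Lemma alg_comph_natural (C : smallCat) (X Y Z : algebra C)
    (f : alg_hom X Y) (g : alg_hom Y Z) i j (c : hom C i j) (x : X i) :
  g j (f j (act X c x)) = act Z c (g i (f i x)).
Proof. by rewrite !alg_natural. Qed.

Definition alg_comph (C : smallCat) (X Y Z : algebra C)
    (f : alg_hom X Y) (g : alg_hom Y Z) : alg_hom X Z :=
  @AlgHom C X Z (fun i x => g i (f i x)) (alg_comph_natural f g).

(* The triples (c, o, x) in the sum over j of C[i,j] * O * \int X; the first
   component of the dependent pair is the target j of c. *)
Definition triple (C : smallCat) (O : Type) (X : C -> Type) (i : C) : Type :=
  {j : C & (hom C i j * O * total X)%type}.

Definition Triple (C : smallCat) (O : Type) (X : C -> Type) (i j : C)
    (c : hom C i j) (o : O) (x : total X) : triple O X i :=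
  existT (fun j => (hom C i j * O * total X)%type) j (c, o, x).

Definition G (C : smallCat) (O : Type) (X : C -> Type) (i : C) : Type :=
  {A : set (triple O X i) | countable A}.

Lemma G_eq (C : smallCat) (O : Type) (X : C -> Type) (i : C) (A B : G O X i) :
  sval A = sval B -> A = B.
Proof.
case: A B => [A cA] [B cB] /= AB; case: _ / AB cB => cB.
by rewrite (Prop_irrelevance cA cB).
Qed.


Lemma countable_triples (C : smallCat) (O : Type) (X : C -> Type) (i : C)
    (hC : countable_arrows C) (A : set (triple O X i)) :
  (forall j (c : hom C i j),
    countable [set z : O * total X | A (Triple c z.1 z.2)]) ->
  countable A.
Proof.
move=> hA.
have cD : countable [set: {j : C & hom C i j}].
  have /countable_injP[f finj] := hC.
  apply/countable_injP; exists (fun c => f (existT _ i c)) => c d _ _ fcd.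
  exact: inj_existT (finj _ _ (mem_set I) (mem_set I) fcd).
have -> : A = \bigcup_(c in [set: {j : C & hom C i j}])
    ((fun z : O * total X => Triple (projT2 c) z.1 z.2) @`
      [set z | A (Triple (projT2 c) z.1 z.2)]).
  apply/seteqP; split => [[j [[c o] x]] Ax|t [[j c] _ [z Az <-]]] //.
  by exists (existT _ j c) => //; exists (o, x).
apply: bigcup_countable => // -[j c] _.
exact: sub_countable (card_image_le _ _) (hA j c).
Qed.

Definition precomp (C : smallCat) (O : Type) (X : C -> Type) (i k : C)
    (d : hom C i k) (t : triple O X k) : triple O X i :=
  Triple (d ;; (projT2 t).1.1) (projT2 t).1.2 (projT2 t).2.

Lemma countable_precomp (C : smallCat) (hC : countable_arrows C) (O : Type)
    (X : C -> Type) (i k : C) (d : hom C i k) (A : set (triple O X i)) :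
  countable A -> countable [set t | A (precomp d t)].
Proof.
move=> cA; apply: countable_triples => // j c.
have /countable_injP[f finj] := cA.
apply/countable_injP; exists (fun z => f (Triple (d ;; c) z.1 z.2)).
move=> [o x] [o' x'] /set_mem Az /set_mem Az' E.
have H := finj _ _ (mem_set Az) (mem_set Az') E.
by have [-> ->] := inj_existT H.
Qed.

(* d_H(X)(A) = {(c2, o, x) | (d;c2, o, x) in A}. *)
Definition H_act (C : smallCat) (hC : countable_arrows C) (O : Type)
    (X : C -> Type) (i k : C) (d : hom C i k) (A : G O X i) : G O X k :=
  exist _ [set t | sval A (precomp d t)] (countable_precomp hC d (svalP A)).

Lemma H_act_id (C : smallCat) (hC : countable_arrows C) (O : Type)
    (X : C -> Type) (i : C) (A : G O X i) : H_act hC (idc i) A = A.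
Proof.
apply: G_eq; apply/predeqP => -[j [[c o] x]].
by rewrite /= /precomp /= comp_idl.
Qed.

Lemma H_act_comp (C : smallCat) (hC : countable_arrows C) (O : Type)
    (X : C -> Type) (i j k : C) (d : hom C i j) (e : hom C j k) (A : G O X i) :
  H_act hC (d ;; e) A = H_act hC e (H_act hC d A).
Proof.
apply: G_eq; apply/predeqP => -[l [[c o] x]].
by rewrite /= /precomp /= comp_assoc.
Qed.

Definition H_alg (C : smallCat) (hC : countable_arrows C) (O : Type)
    (X : algebra C) : algebra C :=
  @Algebra C (G O X) (@H_act C hC O X) (@H_act_id C hC O X)
    (@H_act_comp C hC O X).

Definition total_map (C : smallCat) (X Y : algebra C) (h : alg_hom X Y)
    (x : total X) : total Y := existT _ (projT1 x) (h _ (projT2 x)).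

Definition triple_map (C : smallCat) (O : Type) (X Y : algebra C)
    (h : alg_hom X Y) (i : C) (t : triple O X i) : triple O Y i :=
  Triple (projT2 t).1.1 (projT2 t).1.2 (total_map h (projT2 t).2).

Definition H_fun (C : smallCat) (O : Type) (X Y : algebra C)
    (h : alg_hom X Y) (i : C) (A : G O X i) : G O Y i :=
  exist _ (triple_map h (i := i) @` sval A)
    (sub_countable (card_image_le _ _) (svalP A)).

Lemma H_fun_natural (C : smallCat) (hC : countable_arrows C) (O : Type)
    (X Y : algebra C) (h : alg_hom X Y) i k (d : hom C i k)
    (A : H_alg hC O X i) :
  H_fun h (act (H_alg hC O X) d A) = act (H_alg hC O Y) d (H_fun h A).
Proof.
apply: G_eq; apply/seteqP; split => [_ [t At <-]|[j [[c o] y]]] /=.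
  by exists (precomp d t).
case=> -[j' [[c' o'] x]] Ax E.
have ej : j' = j by have := congr1 (@projT1 _ _) E.
case: _ / ej in c o y E *.
have /= [ec eo ey] := inj_existT E.
exists (Triple c o x); first by rewrite /precomp /= -ec -eo.
by rewrite /triple_map /= ey.
Qed.

Definition H_hom (C : smallCat) (hC : countable_arrows C) (O : Type)
    (X Y : algebra C) (h : alg_hom X Y) :
    alg_hom (H_alg hC O X) (H_alg hC O Y) :=
  @AlgHom C (H_alg hC O X) (H_alg hC O Y) (@H_fun C O X Y h)
    (@H_fun_natural C hC O X Y h).

Lemma H_hom_id (C : smallCat) (hC : countable_arrows C) (O : Type)
    (X : algebra C) : H_hom hC O (alg_idh X) = alg_idh (H_alg hC O X).
Proof.
apply: alg_hom_eq => i A; apply: G_eq => /=.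
have -> : triple_map (alg_idh X) (i := i) = @id (triple O X i).
  by apply: funext => -[j [[c o] [k x]]].
by rewrite image_id.
Qed.

Lemma H_hom_comp (C : smallCat) (hC : countable_arrows C) (O : Type)
    (X Y Z : algebra C) (f : alg_hom X Y) (g : alg_hom Y Z) :
  H_hom hC O (alg_comph f g) = alg_comph (H_hom hC O f) (H_hom hC O g).
Proof. by apply: alg_hom_eq => i A; apply: G_eq; rewrite /= image_comp. Qed.

Record coalg (C : smallCat) (hC : countable_arrows C) (O : Type) := Coalg {
  coalg_alg :> algebra C;
  coalg_str : alg_hom coalg_alg (H_alg hC O coalg_alg) }.

Record coalg_hom (C : smallCat) (hC : countable_arrows C) (O : Type)
    (A B : coalg hC O) := CoalgHom {
  coalg_fun :> alg_hom A B;
  coalg_square : alg_comph (coalg_str A) (H_hom hC O coalg_fun) =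
                 alg_comph coalg_fun (coalg_str B) }.

Definition is_final (C : smallCat) (hC : countable_arrows C) (O : Type)
    (Z : coalg hC O) : Prop :=
  forall A : coalg hC O, exists! f : coalg_hom A Z, True.

Record cis := Cis {
  cis_cat : smallCat;
  cis_alg : algebra cis_cat;
  cis_obs : Type;
  cis_tr : set (total cis_alg * cis_obs * total cis_alg) }.

Arguments cis_tr : clear implicits.

(* Passage from p in X_i to \int X. *)
Definition inj_total (C : smallCat) (X : C -> Type) (i : C) (p : X i) :
  total X := existT X i p.

Definition trans (S : cis) (p : total (cis_alg S)) (o : cis_obs S)
  (p' : total (cis_alg S)) : Prop := cis_tr S (p, o, p').

Definition countable_degree (S : cis) : Prop :=
  forall p : total (cis_alg S), countable [set z | trans p z.1 z.2].

Definition saturated_bisimulation (S : cis)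
    (R : forall i, cis_alg S i -> cis_alg S i -> Prop) : Prop :=
  (forall i (p q : cis_alg S i), R i p q -> R i q p) /\
  (forall i (p q : cis_alg S i), R i p q ->
    (forall j (c : hom (cis_cat S) i j),
      R j (act (cis_alg S) c p) (act (cis_alg S) c q)) /\
    (forall o k (p' : cis_alg S k),
      trans (inj_total p) o (inj_total p') ->
      exists q' : cis_alg S k,
        trans (inj_total q) o (inj_total q') /\ R k p' q')).

Definition saturated_bisimilar (S : cis) (i : cis_cat S)
    (p q : cis_alg S i) : Prop :=
  exists2 R, saturated_bisimulation R & R i p q.

Definition sat_set (S : cis) (i : cis_cat S) (p : cis_alg S i) :
    set (triple (cis_obs S) (cis_alg S) i) :=
  [set t | trans (inj_total (act (cis_alg S) (projT2 t).1.1 p))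
             (projT2 t).1.2 (projT2 t).2].

Lemma countable_sat_set (S : cis) (hC : countable_arrows (cis_cat S))
    (hT : countable_degree S) (i : cis_cat S) (p : cis_alg S i) :
  countable (sat_set p).
Proof.
apply: countable_triples => // j c.
exact: (hT (inj_total (act (cis_alg S) c p))).
Qed.

Definition sat_fun (S : cis) (hC : countable_arrows (cis_cat S))
    (hT : countable_degree S) (i : cis_cat S) (p : cis_alg S i) :
    H_alg hC (cis_obs S) (cis_alg S) i :=
  exist _ (sat_set p) (countable_sat_set hC hT p).

Lemma sat_fun_natural (S : cis) (hC : countable_arrows (cis_cat S))
    (hT : countable_degree S) i j (c : hom (cis_cat S) i j)
    (p : cis_alg S i) :
  sat_fun hC hT (act (cis_alg S) c p) =
  act (H_alg hC (cis_obs S) (cis_alg S)) c (sat_fun hC hT p).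
Proof.
apply: G_eq; apply/predeqP => -[k [[d o] x]].
by rewrite /= /sat_set /= act_comp.
Qed.

Definition sat_coalg (S : cis) (hC : countable_arrows (cis_cat S))
    (hT : countable_degree S) : coalg hC (cis_obs S) :=
  @Coalg _ hC _ (cis_alg S)
    (@AlgHom _ (cis_alg S) (H_alg hC (cis_obs S) (cis_alg S))
      (@sat_fun S hC hT) (@sat_fun_natural S hC hT)).

(* Main.v *)
Require Import Defs.
From mathcomp Require Import all_boot.
From mathcomp Require Import boolp classical_sets functions cardinality.

Set Implicit Arguments.
Unset Strict Implicit.
Unset Printing Implicit Defensive.

Local Open Scope classical_set_scope.

(** The functor [G] lives already on [|C|]-indexed families of sets.  Its final
coalgebra [Z] is the type of countably branching trees modulo the largest
bisimulation: every [G]-coalgebra unfolds to trees once its countable successor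
sets are enumerated, and [Z] satisfies the coinduction principle that bisimilar
states have equal images.  As the structure map [out] of [Z] is invertible, [Z]
becomes a [Gamma(C)]-algebra by transporting the operations of [H] along [out];
[out] is then a homomorphism, and the [G]-coalgebra maps from an [H]-coalgebra to
[Z] are automatically homomorphisms, so that [Z] is the final [H]-coalgebra.
Applied to the saturated transition system, coinduction identifies saturated
bisimilar states, while the kernel of a coalgebra morphism is always a saturated
bisimulation. *)

(** * Enumerations of countable sets *)

Lemma countable_option_enum (T : Type) (A : set T) : countable A ->
  exists e : nat -> option T, forall t, A t <-> exists n, e n = Some t.
Proof.
move=> /countable_injP[f finj].
(* [None] fills the indices that [f] does not hit on [A], so empty and finite sets are covered
   too. *)
exists (fun n => if pselect (exists t, A t /\ f t = n) is left h
                 then Some (sval (cid h)) else None) => t; split => [At|[n]].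
  exists (f t); case: pselect => [h|[]]; last by exists t.
  by congr Some; case: (cid h) => s [As /= E]; apply: finj; rewrite ?inE.
by case: pselect => // h [<-]; case: (cid h) => s [].
Qed.

(** Sending a value to a chosen index where it occurs is injective, since [e] recovers the value;
    the default [0] is never taken on the range. *)
Lemma countable_option_range (T : Type) (e : nat -> option T) :
  countable [set t | exists n, e n = Some t].
Proof.
have get t : (exists n, e n = Some t) -> e (xget 0 [set n | e n = Some t]) = Some t.
  by case=> n en; apply: (@xgetPex _ 0 [set n | e n = Some t]); exists n.
apply/countable_injP; exists (fun t => xget 0 [set n | e n = Some t]).
by move=> s t /set_mem/get es /set_mem/get et E; move: es; rewrite E et => -[].
Qed.

(** * The functor [G] on families, its relation lifting and its trees *)

Section FamilyCoalgebras.
Context (C : smallCat) (O : Type).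
Implicit Types X Y : C -> Type.

(** Unlike [triple_map], this takes a bare family of functions: trees carry no operations, so
    [unfold] and [cls] are not homomorphisms. *)
Definition map_triple X Y (h : forall i, X i -> Y i) i (t : triple O X i) :
    triple O Y i :=
  Triple (projT2 t).1.1 (projT2 t).1.2
    (inj_total (h _ (projT2 (projT2 t).2))).

Definition Gmap X Y (h : forall i, X i -> Y i) i (A : G O X i) : G O Y i :=
  exist _ (map_triple h (i := i) @` sval A)
    (sub_countable (card_image_le _ _) (svalP A)).

Lemma mem_Gmap X Y (h : forall i, X i -> Y i) i (A : G O X i)
    j (c : hom C i j) o k (y : Y k) :
  sval (Gmap h A) (Triple c o (inj_total y)) <->
  exists2 x, sval A (Triple c o (inj_total x)) & h k x = y.
Proof.
split=> [[[j' [[c' o'] [k' x]]] Ax E]|[x Ax <-]]; last first.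
  by exists (Triple c o (inj_total x)).
have ej : j' = j by have := congr1 (@projT1 _ _) E.
case: _ / ej in c E *; have {}E := inj_existT E.
have [<- <-] : c' = c /\ o' = o by case: E.
have {}E : inj_total (h k' x) = inj_total y by have := congr1 snd E.
have ek : k' = k by have := congr1 (@projT1 _ _) E.
by case: _ / ek in y E *; exists x => //; exact: inj_existT E.
Qed.

Lemma G_ext X i (A B : G O X i) :
  (forall j (c : hom C i j) o k (x : X k),
    sval A (Triple c o (inj_total x)) <-> sval B (Triple c o (inj_total x))) ->
  A = B.
Proof. by move=> AB; apply: G_eq; apply/predeqP => -[j [[c o] [k x]]]; apply: AB. Qed.

Lemma Gmap_comp X Y (W : C -> Type) (f : forall i, X i -> Y i)
    (g : forall i, Y i -> W i) i (A : G O X i) :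
  Gmap g (Gmap f A) = Gmap (fun k x => g k (f k x)) A.
Proof. by apply: G_eq; rewrite /= image_comp. Qed.

Lemma Gmap_id X (f : forall i, X i -> X i) i (A : G O X i) :
  (forall k x, f k x = x) -> Gmap f A = A.
Proof.
move=> fid; apply: G_ext => j c o k x; split=> [/mem_Gmap[y Ay]|Ax].
  by rewrite fid => <-.
by apply/mem_Gmap; exists x.
Qed.

Lemma Gmap_act (hC : countable_arrows C) X Y (f : forall i, X i -> Y i)
    i k (d : hom C i k) (A : G O X i) :
  Gmap f (H_act hC d A) = H_act hC d (Gmap f A).
Proof.
apply: G_ext => j c o l y; split => [/mem_Gmap[x Ax <-]|/mem_Gmap[x Ax <-]];
  by apply/mem_Gmap; exists x.
Qed.

(** The Egli-Milner lifting of [R]: a bisimulation is a relation contained in the pullback of its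
    own lifting. *)
Definition lift X Y (R : forall i, X i -> Y i -> Prop) i
    (A : G O X i) (B : G O Y i) : Prop :=
  (forall j (c : hom C i j) o k (x : X k),
     sval A (Triple c o (inj_total x)) ->
     exists2 y, sval B (Triple c o (inj_total y)) & R k x y) /\
  (forall j (c : hom C i j) o k (y : Y k),
     sval B (Triple c o (inj_total y)) ->
     exists2 x, sval A (Triple c o (inj_total x)) & R k x y).

Lemma lift_mono X Y (R R' : forall i, X i -> Y i -> Prop) :
  (forall i x y, R i x y -> R' i x y) ->
  forall i (A : G O X i) (B : G O Y i), lift R A B -> lift R' A B.
Proof.
move=> RR' i A B [AB BA]; split => j c o k x.
  by move=> /AB[y By Rxy]; exists y => //; exact: RR'.
by move=> /BA[y Ay Ryx]; exists y => //; exact: RR'.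
Qed.

Lemma lift_refl X (R : forall i, X i -> X i -> Prop) :
  (forall i x, R i x x) -> forall i (A : G O X i), lift R A A.
Proof. by move=> Rxx i A; split=> j c o k x Ax; exists x. Qed.

Lemma lift_sym X Y (R : forall i, X i -> Y i -> Prop) i
    (A : G O X i) (B : G O Y i) :
  lift R A B -> lift (fun k y x => R k x y) B A.
Proof. by case. Qed.

Lemma lift_comp X Y (W : C -> Type) (R : forall i, X i -> Y i -> Prop)
    (R' : forall i, Y i -> W i -> Prop) i
    (A : G O X i) (B : G O Y i) (D : G O W i) :
  lift R A B -> lift R' B D ->
  lift (fun k x w => exists2 y, R k x y & R' k y w) A D.
Proof.
move=> [AB BA] [BD DB]; split=> j c o k x.
  by move=> /AB[y /BD[w Dw Ryw] Rxy]; exists w => //; exists y.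
by move=> /DB[y /BA[w Aw Rwy] Ryx]; exists w => //; exists y.
Qed.

(** The bridge between equations of coalgebra maps and bisimulation clauses. *)
Lemma Gmap_eqP X Y (W : C -> Type) (f : forall i, X i -> W i)
    (g : forall i, Y i -> W i) i (A : G O X i) (B : G O Y i) :
  Gmap f A = Gmap g B <-> lift (fun k x y => f k x = g k y) A B.
Proof.
split=> [E|[AB BA]].
  split=> j c o k x Ax.
    have /mem_Gmap[y By Ey] : sval (Gmap g B) (Triple c o (inj_total (f k x))).
      by rewrite -E; apply/mem_Gmap; exists x.
    by exists y.
  have /mem_Gmap[y By Ey] : sval (Gmap f A) (Triple c o (inj_total (g k x))).
    by rewrite E; apply/mem_Gmap; exists x.
  by exists y.
apply: G_ext => j c o k w; split => /mem_Gmap[x].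
  by move=> /AB[y By ->] <-; apply/mem_Gmap; exists y.
by move=> /BA[y Ay <-] <-; apply/mem_Gmap; exists y.
Qed.

(** Successors are enumerated because [tree] would occur negatively in a set of triples; the order
    and repetitions disappear in the quotient by [bisim]. *)
CoInductive tree (i : C) : Type :=
  Node of (nat -> option (triple O tree i)).

Definition branches i (t : tree i) : nat -> option (triple O tree i) :=
  let: Node b := t in b.

Definition children i (t : tree i) : G O tree i :=
  exist _ [set s | exists n, branches t n = Some s]
    (countable_option_range (branches t)).

Definition enumG X i (A : G O X i) : nat -> option (triple O X i) :=
  sval (cid (countable_option_enum (svalP A))).

Lemma enumGP X i (A : G O X i) t : sval A t <-> exists n, enumG A n = Some t.
Proof. by rewrite /enumG; case: cid => e /=; apply. Qed.

Lemma children_Node i (A : G O tree i) : children (Node (enumG A)) = A.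
Proof. by apply: G_eq; apply/predeqP => t; apply: iff_sym; exact: enumGP. Qed.

CoFixpoint unfold X (alpha : forall i, X i -> G O X i) i (x : X i) : tree i :=
  Node (fun n => omap (map_triple (unfold alpha) (i := i)) (enumG (alpha i x) n)).

Lemma children_unfold X (alpha : forall i, X i -> G O X i) i (x : X i) :
  children (unfold alpha x) = Gmap (unfold alpha) (alpha i x).
Proof.
apply: G_eq; apply/seteqP; split => t /=.
  case=> n; case E: (enumG _ n) => [s|] //= -[<-].
  by exists s => //; apply/enumGP; exists n.
by case=> s /enumGP[n E] <-; exists n; rewrite E.
Qed.

(** * The quotient of trees by bisimilarity, and coinduction *)

Definition bisim i (t t' : tree i) : Prop :=
  exists2 R : forall i, tree i -> tree i -> Prop,
    forall i s s', R i s s' -> lift R (children s) (children s') & R i t t'.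

Lemma bisim_lift i (t t' : tree i) :
  bisim t t' -> lift bisim (children t) (children t').
Proof.
by case=> R bR /bR; apply: lift_mono => k s s' Rss'; exists R.
Qed.

Lemma bisim_refl i (t : tree i) : bisim t t.
Proof.
by exists (fun _ s s' => s = s') => // k s _ <-; apply: lift_refl.
Qed.

Lemma bisim_sym i (t t' : tree i) : bisim t t' -> bisim t' t.
Proof.
move=> [R bR Rtt']; exists (fun k s s' => R k s' s) => // k s s' /bR.
exact: lift_sym.
Qed.

Lemma bisim_trans i (t t' t'' : tree i) :
  bisim t t' -> bisim t' t'' -> bisim t t''.
Proof.
move=> tt' t't''.
exists (fun k s s'' => exists2 s', bisim s s' & bisim s' s''); last by exists t'.
by move=> k s s'' [s' /bisim_lift ss' /bisim_lift s's'']; apply: lift_comp ss' s's''.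
Qed.

Definition Z (i : C) : Type := {B : set (tree i) | exists t, B = bisim t}.

Lemma Z_eq i (z z' : Z i) : sval z = sval z' -> z = z'.
Proof.
case: z z' => [A eA] [B eB] /= AB; case: _ / AB eB => eB.
by rewrite (Prop_irrelevance eA eB).
Qed.

Definition cls i (t : tree i) : Z i := exist _ (bisim t) (ex_intro _ t erefl).

Definition rep i (z : Z i) : tree i := sval (cid (svalP z)).

Lemma clsP i (t t' : tree i) : cls t = cls t' <-> bisim t t'.
Proof.
split=> [/(congr1 sval)/= ->|tt']; first exact: bisim_refl.
apply: Z_eq; apply/predeqP => s; split; apply: bisim_trans => //.
exact: bisim_sym.
Qed.

Lemma repK i (z : Z i) : cls (rep z) = z.
Proof. by apply: Z_eq; rewrite /rep /=; case: (cid (svalP z)). Qed.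

Definition out i (z : Z i) : G O Z i := Gmap cls (children (rep z)).

(** Independence of [out] from the chosen representative: bisimilar trees have children that agree
    up to [cls]. *)
Lemma out_cls i (t : tree i) : out (cls t) = Gmap cls (children t).
Proof.
apply/Gmap_eqP; have /clsP/bisim_lift := repK (cls t).
by apply: lift_mono => k s s' /clsP.
Qed.

Lemma Z_coinduction X Y (alpha : forall i, X i -> G O X i)
    (beta : forall i, Y i -> G O Y i) (f : forall i, X i -> Z i)
    (g : forall i, Y i -> Z i) (R : forall i, X i -> Y i -> Prop) :
  (forall i x, out (f i x) = Gmap f (alpha i x)) ->
  (forall i y, out (g i y) = Gmap g (beta i y)) ->
  (forall i x y, R i x y -> lift R (alpha i x) (beta i y)) ->
  forall i x y, R i x y -> f i x = g i y.
Proof.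
move=> falpha gbeta bR i x y Rxy.
rewrite -[f i x]repK -[g i y]repK; apply/clsP.
(* [R] is carried over to the trees representing its images; each of the three factors of this
   composite is lifted separately. *)
exists (fun k s s' => exists2 v, (exists2 u, cls s = f k u & R k u v)
                                 & g k v = cls s'); last first.
  by exists y; [exists x; rewrite ?repK|rewrite repK].
move=> k s s' [v [u Es Ruv] Es'].
have su : lift (fun k s u => cls s = f k u) (children s) (alpha k u).
  by apply/Gmap_eqP; rewrite -out_cls Es.
have vs' : lift (fun k v s' => g k v = cls s') (beta k v) (children s').
  by apply/Gmap_eqP; rewrite -out_cls -Es'.
exact: lift_comp (lift_comp su (bR _ _ _ Ruv)) vs'.
Qed.

Lemma out_inj i : injective (@out i).
Proof.
move=> z z' E.
have outid k (w : Z k) : out w = Gmap (fun _ v => v) (out w) by rewrite Gmap_id.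
(* Both coalgebra maps are identities. Equality joins the relation because states with equal [out]
   have the very same successors. *)
apply: (Z_coinduction outid outid
  (R := fun k w w' => w = w' \/ out w = out w')); last by right.
move=> k w w' ww'; have -> : out w = out w' by case: ww' => [->|].
by apply: lift_refl => l v; left.
Qed.

Definition into i (A : G O Z i) : Z i := cls (Node (enumG (Gmap rep A))).

Lemma intoK i (A : G O Z i) : out (into A) = A.
Proof. by rewrite out_cls children_Node Gmap_comp Gmap_id // => k z; rewrite repK. Qed.

(** * Operations on [Z] and finality among [H]-coalgebras *)

Context (hC : countable_arrows C).

Definition Z_act i j (d : hom C i j) (z : Z i) : Z j :=
  into (H_act hC d (out z)).

Lemma Z_act_id i (z : Z i) : Z_act (idc i) z = z.
Proof. by apply: out_inj; rewrite intoK H_act_id. Qed.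

Lemma Z_act_comp i j k (d : hom C i j) (e : hom C j k) (z : Z i) :
  Z_act (d ;; e) z = Z_act e (Z_act d z).
Proof. by apply: out_inj; rewrite !intoK H_act_comp. Qed.

Definition Z_alg : algebra C := @Algebra C Z Z_act Z_act_id Z_act_comp.

Lemma out_natural i j (c : hom C i j) (z : Z_alg i) :
  out (act Z_alg c z) = act (H_alg hC O Z_alg) c (out z).
Proof. exact: intoK. Qed.

Definition Z_coalg : coalg hC O :=
  @Coalg C hC O Z_alg (@AlgHom C Z_alg (H_alg hC O Z_alg) out out_natural).

(** The coalgebra square read pointwise; [H_fun f] and [Gmap f] are convertible. *)
Lemma coalg_homE (A B : coalg hC O) (f : coalg_hom A B) i (x : A i) :
  alg_fun (coalg_str B) i (f i x) = Gmap f (coalg_str A i x).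
Proof.
exact: esym (congr1 (fun h : alg_hom A (H_alg hC O B) => h i x)
                    (coalg_square f)).
Qed.

Lemma coalg_hom_eq (A B : coalg hC O) (f g : coalg_hom A B) :
  (forall i x, f i x = g i x) -> f = g.
Proof.
case: f g => [f hf] [g hg] /= /alg_hom_eq fg.
by case: _ / fg hg => hg; rewrite (Prop_irrelevance hf hg).
Qed.

Definition coalg_comph (A B D : coalg hC O) (f : coalg_hom A B)
    (g : coalg_hom B D) : coalg_hom A D.
Proof.
exists (alg_comph f g); apply: alg_hom_eq => i x /=.
by rewrite !coalg_homE Gmap_comp.
Defined.

Definition behaviour_fun (A : coalg hC O) i (x : A i) : Z i :=
  cls (unfold (coalg_str A) x).

Lemma out_behaviour (A : coalg hC O) i (x : A i) :
  out (behaviour_fun x) = Gmap (@behaviour_fun A) (coalg_str A i x).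
Proof. by rewrite out_cls children_unfold Gmap_comp. Qed.

(** After applying the injective [out], this is naturality of the structure map of [A] together with
    [Gmap_act]. *)
Lemma behaviour_natural (A : coalg hC O) i j (c : hom C i j) (x : A i) :
  behaviour_fun (act A c x) = act Z_alg c (behaviour_fun x).
Proof.
apply: out_inj.
by rewrite out_natural !out_behaviour alg_natural; exact: Gmap_act.
Qed.

Definition behaviour (A : coalg hC O) : coalg_hom A Z_coalg.
Proof.
exists (@AlgHom C A Z_alg (@behaviour_fun A) (@behaviour_natural A)).
by apply: alg_hom_eq => i x; rewrite [RHS]out_behaviour.
Defined.

Lemma Z_final : is_final Z_coalg.
Proof.
move=> A; exists (behaviour A); split=> // f _.
apply: coalg_hom_eq => i x.
apply: (Z_coinduction (coalg_homE (behaviour A)) (coalg_homE f)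
  (R := fun _ x y => x = y)) => // k y _ <-.
exact: lift_refl.
Qed.

End FamilyCoalgebras.

(** * Saturated bisimilarity as the kernel *)

Lemma saturated_bisimilar_behaviour (S : cis) (hC : countable_arrows (cis_cat S))
    (hT : countable_degree S) (i : cis_cat S) (p q : cis_alg S i) :
  saturated_bisimilar p q ->
  behaviour (sat_coalg hC hT) i p = behaviour (sat_coalg hC hT) i q.
Proof.
case=> R [symR bR].
have hom := coalg_homE (behaviour (sat_coalg hC hT)).
apply: (Z_coinduction hom hom) => {i p q} i p q Rpq.
split=> j c o k p' pp'.
  (* A saturated move of [p] labelled [c] is a move of [c] applied to [p], so [R] is first
     transported along [c]. *)
  have [/(_ j c)Rc _] := bR _ _ _ Rpq.
  by have [_ /(_ _ _ _ pp')[q' [qq' Rq']]] := bR _ _ _ Rc; exists q'.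
have [/(_ j c)Rc _] := bR _ _ _ (symR _ _ _ Rpq).
have [_ /(_ _ _ _ pp')[q' [qq' Rq']]] := bR _ _ _ Rc.
by exists q' => //; exact: symR.
Qed.

Lemma kernel_saturated_bisimulation (S : cis)
    (hC : countable_arrows (cis_cat S)) (hT : countable_degree S)
    (B : coalg hC (cis_obs S)) (f : coalg_hom (sat_coalg hC hT) B) :
  saturated_bisimulation (fun i (p q : cis_alg S i) => f i p = f i q).
Proof.
split=> [i p q //|i p q fpq]; split=> [j c|o k p' pp'].
  by have := congr1 (act B c) fpq; rewrite -!(alg_natural f).
have /Gmap_eqP[fpq' _] : Gmap f (sat_fun hC hT p) = Gmap f (sat_fun hC hT q).
  by have := coalg_homE f p; rewrite fpq coalg_homE.
(* Plain moves of [p] are its saturated moves labelled by the identity. *)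
have [|q' qq' E] := fpq' i (idc i) o k p'; first by rewrite /= /sat_set /= act_id.
by exists q' => //; move: qq'; rewrite /= /sat_set /= act_id.
Qed.

Theorem mainTheorem3 (S : cis) (hC : countable_arrows (cis_cat S))
    (hT : countable_degree S) :
  (exists Z : coalg hC (cis_obs S), is_final Z) /\
  (forall Z : coalg hC (cis_obs S), is_final Z ->
   forall (bang : coalg_hom (sat_coalg hC hT) Z)
     (i : cis_cat S) (p q : cis_alg S i),
     saturated_bisimilar p q <->
     alg_fun (coalg_fun bang) i p = alg_fun (coalg_fun bang) i q).
Proof.
split=> [|Z Zfin bang i p q].
  by exists (Z_coalg (cis_obs S) hC); exact: Z_final.
split=> [pq|E]; last first.
  by eexists; first exact: (kernel_saturated_bisimulation bang).
(* [Z] is an arbitrary final object: by uniqueness [bang] equals [behaviour] followed by the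
   morphism [u] from [Z_coalg] to [Z]. *)
have [u _] := Zfin (Z_coalg (cis_obs S) hC).
have [v [_ vP]] := Zfin (sat_coalg hC hT).
rewrite -(vP bang I) (vP (coalg_comph (behaviour _) u) I).
by congr (u i _); exact: saturated_bisimilar_behaviour.
Qed.
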